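(* Let $P$ be an Eulerian poset of rank $r$, and let $\widehat{P}$ be the poset of all closed intervals of $P$, including the empty set, ordered by reverse inclusion. Then the (Eulerian) Chow polynomial $\mathrm{H}_{\widehat{P}}(x)$ of $\widehat{P}$ equals the second Veronese transform of the (Eulerian) Chow polynomial $\mathrm{H}_P(x)$ of $P$ with respect to degree $d=r$. In particular, the Chow polynomial of $P$ determines the Chow polynomial of $\widehat{P}$ and vice versa: if $P_1,P_2$ are Eulerian posets of rank $r$, then $\mathrm{H}_{P_1}(x)=\mathrm{H}_{P_2}(x)$ if and only if $\mathrm{H}_{\widehat{P_1}}(x)=\mathrm{H}_{\widehat{P_2}}(x)$.
   Context: All posets are finite and bounded, with minimum $\widehat0$ and maximum $\widehat1$. A poset $P$ is graded if all its maximal chains have the same length; $\rho$ denotes its rank function ($\rho(\widehat0)=0$), $\rho_{st}=\rho(t)-\rho(s)$ for $s\le t$, and the rank of $P$ is $\rho(\widehat1)$. A graded bounded poset is Eulerian if its Möbius function satisfies $\mu_{st}=(-1)^{\rho_{st}}$ for all $s\le t$. $\mathcal{I}(P)$ is the incidence algebra: functions $a$ assigning to each nonempty closed interval $[s,t]$ a polynomial $a_{st}(x)\in\mathbb{Z}[x]$, with product $(ab)_{st}=\sum_{s\le w\le t}a_{sw}b_{wt}$; its identity is $\delta$ with $\delta_{ss}=1$ and $\delta_{st}=0$ for $s<t$. Chow polynomial: for $P$ Eulerian define $\overline{\varepsilon}\in\mathcal{I}(P)$ by $\overline\varepsilon_{st}(x)=(x-1)^{\rho_{st}-1}$ for $s<t$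 and $\overline\varepsilon_{ss}(x)=-1$. The Chow function is $\mathrm{H}=-(\overline\varepsilon)^{-1}\in\mathcal{I}(P)$ and the Chow polynomial of $P$ is $\mathrm{H}_P(x)=\mathrm{H}_{\widehat0\,\widehat1}(x)$. Poset of intervals: $\widehat{P}=\{[s,t]:s\le t\text{ in }P\}\cup\{\varnothing\}$ ordered by reverse inclusion, with minimum $[\widehat0,\widehat1]$ and maximum $\varnothing$. By a theorem of Lindström it is Eulerian whenever $P$ is, and it has rank $r+1$ if $P$ has rank $r$. Veronese transform: let $h(x)=\sum_i h_ix^i$ be a polynomial of degree at most $d$, and define $(a_n)_{n\ge0}$ by $\sum_{n\ge0}a_nx^n=\dfrac{h(x)}{(1-x)^{d+1}}$. The $m$-th Veronese transform of $h$ with respect to degree $d$ is the unique polynomial $h'(x)=h'_0+h'_1x+\cdots+h'_dx^d$ such that $\sum_{n\ge0}a_{mn}x^n=\dfrac{h'(x)}{(1-x)^{d+1}}$. *)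

(* Defs.v *)
From HB Require Import structures.
From mathcomp Require Import all_boot all_order all_algebra.

Set Implicit Arguments.
Unset Strict Implicit.
Unset Printing Implicit Defensive.

Import Order.TTheory GRing.Theory.
Local Open Scope ring_scope.

Section Graded.
Context {d : Order.disp_t} (P : finTBPOrderType d).
Implicit Types (s t : P) (C D : {set P}).

Definition is_chain C : bool :=
  [forall x in C, forall y in C, (x >=< y)%O].

Definition maximal_chain C : bool := maxset is_chain C.

Definition graded : Prop :=
  forall C D, maximal_chain C -> maximal_chain D -> #|C| = #|D|.

(* [rk t] is the largest length [#|C| - 1] of a chain of [[\bot, t]]; when [P]
   is graded, all maximal chains of [[\bot, t]] have this length. *)
Definition rk t : nat :=
  (\max_(C : {set P} | is_chain C && [forall x in C, (x <= t)%O]) #|C|).-1.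

(* Only meaningful for [(s <= t)%O], because the subtraction truncates. *)
Definition rk_itv s t : nat := (rk t - rk s)%N.

Definition poset_rank : nat := rk \top%O.

End Graded.

Section IncidenceType.
Context {d : Order.disp_t} (P : finTBPOrderType d) (R : comUnitRingType).

(* A function on the nonempty closed intervals [[s, t]] is encoded as a
   function of the pair [(s, t)] that vanishes when [s] is not below [t]. *)
Definition inc_supp : {pred {ffun P * P -> R}} :=
  [pred f : {ffun P * P -> R} |
    [forall p : P * P, (p.1 <= p.2)%O || (f p == 0)]].

Record incidence := Incidence {
  inc_val : {ffun P * P -> R};
  _ : inc_val \in inc_supp
}.

HB.instance Definition _ := [isSub for inc_val].
HB.instance Definition _ := [Choice of incidence by <:].

Fact inc_supp_zmod_closed : zmod_closed inc_supp.
Proof.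
split=> [|f g /forallP fP /forallP gP].
  by apply/forallP=> p; rewrite ffunE eqxx orbT.
apply/forallP=> p; have := fP p; have := gP p.
case: (p.1 <= p.2)%O => //= /eqP gp0 /eqP fp0.
by rewrite !ffunE fp0 gp0 subr0.
Qed.

HB.instance Definition _ :=
  GRing.isZmodClosed.Build {ffun P * P -> R} inc_supp inc_supp_zmod_closed.
HB.instance Definition _ := [SubChoice_isSubZmodule of incidence by <:].

Definition inc_fun (a : incidence) (s t : P) : R := inc_val a (s, t).

Fact inc_of_subproof (f : P -> P -> R) :
  [ffun p : P * P => if (p.1 <= p.2)%O then f p.1 p.2 else 0] \in inc_supp.
Proof. by apply/forallP=> p; rewrite ffunE; case: ifP => //; rewrite eqxx. Qed.

(* The values of [f] outside the intervals are ignored. *)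
Definition inc_of (f : P -> P -> R) : incidence :=
  Incidence (inc_of_subproof f).

End IncidenceType.

Coercion inc_fun : incidence >-> Funclass.
Arguments inc_of {d P R} f.

Section IncidenceRing.
Context {d : Order.disp_t} (P : finTBPOrderType d) (R : comUnitRingType).
Implicit Types (a b c : incidence P R) (s t w : P).

Lemma inc_ofE (f : P -> P -> R) s t :
  inc_of f s t = if (s <= t)%O then f s t else 0.
Proof. by rewrite /inc_fun ffunE. Qed.

Lemma inc_eq0 a s t : ~~ (s <= t)%O -> a s t = 0.
Proof.
move=> /negPf nst; case: a => f fP; rewrite /inc_fun /=.
by have /forallP/(_ (s, t)) := fP; rewrite /= nst => /eqP.
Qed.

Lemma incP a b : (forall s t, (s <= t)%O -> a s t = b s t) -> a = b.
Proof.
move=> eq_ab; apply/val_inj/ffunP => -[s t].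
have [/eq_ab //|nst] := boolP (s <= t)%O.
by rewrite -/(inc_fun a s t) -/(inc_fun b s t) !inc_eq0.
Qed.

Lemma inc_addE a b s t : (a + b) s t = a s t + b s t.
Proof. by rewrite /inc_fun ffunE. Qed.

Lemma inc_oppE a s t : (- a) s t = - a s t.
Proof. by rewrite /inc_fun ffunE. Qed.

Lemma inc_zeroE s t : (0 : incidence P R) s t = 0.
Proof. by rewrite /inc_fun ffunE. Qed.

Definition inc_one : incidence P R := inc_of (fun s t => (s == t)%:R).

Definition inc_mul a b : incidence P R :=
  inc_of (fun s t => \sum_(w | (s <= w <= t)%O) a s w * b w t).

Lemma inc_oneE_ s t : inc_one s t = (s == t)%:R.
Proof. by rewrite inc_ofE; case: eqVneq => [->|_]; rewrite ?lexx ?if_same. Qed.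

Lemma inc_mulE_ a b s t : inc_mul a b s t = \sum_w a s w * b w t.
Proof.
have mulf0 w : ~~ (s <= w <= t)%O -> a s w * b w t = 0.
  by rewrite negb_and => /orP[] /inc_eq0 ->; rewrite ?mul0r ?mulr0.
rewrite inc_ofE [RHS](bigID (fun w => (s <= w <= t)%O)) /=.
rewrite [X in _ = _ + X]big1 ?addr0 => [|w /mulf0 //].
case: ifPn => // nst; rewrite big_pred0 // => w.
by apply: contraNF nst => /andP[]; apply: le_trans.
Qed.

Fact inc_mulA : associative inc_mul.
Proof.
move=> a b c; apply: incP => s t _; rewrite !inc_mulE_.
under eq_bigr do rewrite inc_mulE_ mulr_sumr.
rewrite exchange_big /=; apply: eq_bigr => v _.
by rewrite inc_mulE_ mulr_suml; apply: eq_bigr => w _; rewrite mulrA.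
Qed.

Fact inc_mul1 : left_id inc_one inc_mul.
Proof.
move=> a; apply: incP => s t _; rewrite inc_mulE_ (bigD1 s) //= inc_oneE_ eqxx.
rewrite mul1r big1 ?addr0 // => w; rewrite eq_sym inc_oneE_ => /negPf->.
by rewrite mul0r.
Qed.

Fact inc_mulr1 : right_id inc_one inc_mul.
Proof.
move=> a; apply: incP => s t _; rewrite inc_mulE_ (bigD1 t) //= inc_oneE_ eqxx.
rewrite mulr1 big1 ?addr0 // => w; rewrite inc_oneE_ => /negPf->.
by rewrite mulr0.
Qed.

Fact inc_mulDl : left_distributive inc_mul +%R.
Proof.
move=> a b c; apply: incP => s t _; rewrite inc_addE !inc_mulE_ -big_split /=.
by apply: eq_bigr => w _; rewrite inc_addE mulrDl.
Qed.

Fact inc_mulDr : right_distributive inc_mul +%R.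
Proof.
move=> a b c; apply: incP => s t _; rewrite inc_addE !inc_mulE_ -big_split /=.
by apply: eq_bigr => w _; rewrite inc_addE mulrDr.
Qed.

Fact inc_one_neq0 : inc_one != 0.
Proof.
apply/eqP=> /(congr1 (fun a : incidence P R => a \bot%O \bot%O)).
by rewrite inc_zeroE inc_oneE_ eqxx; apply/eqP; exact: oner_neq0.
Qed.

HB.instance Definition _ := GRing.Zmodule_isNzRing.Build (incidence P R)
  inc_mulA inc_mul1 inc_mulr1 inc_mulDl inc_mulDr inc_one_neq0.

Lemma inc_oneE s t : (1 : incidence P R) s t = (s == t)%:R.
Proof. exact: inc_oneE_. Qed.

Lemma inc_mulE a b s t : (s <= t)%O ->
  (a * b) s t = \sum_(w | (s <= w <= t)%O) a s w * b w t.
Proof. by move=> st; rewrite [LHS]inc_ofE st. Qed.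

Lemma inc_mul_diag a b s : (a * b) s s = a s s * b s s.
Proof.
rewrite inc_mulE // (big_pred1 s) // => w /=.
by rewrite eq_sym [in RHS]eq_le.
Qed.

(* Multiplicative inverses: write [a = D * (1 - N)] with [D] the diagonal of
   [a]; then [N] is nilpotent and [a^-1] is the geometric sum of [N] times
   [D^-1]. *)

Definition inc_unit : pred (incidence P R) :=
  [pred a : incidence P R | [forall s : P, a s s \is a GRing.unit]].

Let inc_diag a : incidence P R := inc_of (fun s t => if s == t then a s s else 0).
Let inc_dinv a : incidence P R :=
  inc_of (fun s t => if s == t then (a s s)^-1 else 0).
Let inc_nil a : incidence P R := 1 - inc_dinv a * a.

Definition inc_inv a : incidence P R :=
  if a \in inc_unit then (\sum_(k < #|P|) inc_nil a ^+ k) * inc_dinv a else a.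

Let diagE (f : P -> R) s t :
  inc_of (fun s t => if s == t then f s else 0) s t = if s == t then f s else 0.
Proof. by rewrite inc_ofE; case: eqVneq => [->|_]; rewrite ?lexx ?if_same. Qed.

Let diag_mul (f g : P -> R) : (forall s, f s * g s = 1) ->
  inc_of (fun s t => if s == t then f s else 0)
    * inc_of (fun s t => if s == t then g s else 0) = 1.
Proof.
move=> fg1; apply: incP => s t _; rewrite [LHS]inc_mulE_ (bigD1 s) //= !diagE eqxx.
rewrite big1 ?addr0 => [|w]; last by rewrite eq_sym diagE => /negPf->; rewrite mul0r.
by rewrite inc_oneE; case: eqP => [_|_]; rewrite ?fg1 ?mulr0.
Qed.

Let nil_pow a k s t : (forall w, a w w = 0) ->
  (#|[set w | (s <= w <= t)%O]| <= k)%N -> (a ^+ k) s t = 0.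
Proof.
move=> a0; elim: k s => [|k IHk] s.
  rewrite leqn0 cards_eq0 => /eqP/setP/(_ s); rewrite !inE lexx /= => st.
  by rewrite inc_eq0 ?st.
move=> le_k; rewrite exprS [LHS]inc_mulE_ big1 // => w _.
have [<-|sw] := eqVneq s w; first by rewrite a0 mul0r.
have [le_sw|/inc_eq0->] := boolP (s <= w)%O; last by rewrite mul0r.
have [le_wt|/inc_eq0->] := boolP (w <= t)%O; last by rewrite mulr0.
rewrite IHk ?mulr0 // -ltnS; apply: leq_trans le_k; apply: proper_card.
apply/properP; split.
  by apply/subsetP=> v; rewrite !inE => /andP[/(le_trans le_sw)-> ->].
exists s; first by rewrite inE lexx (le_trans le_sw).
by rewrite inE negb_and lt_geF // lt_neqAle sw.
Qed.

Let inc_unitE a : a \in inc_unit ->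
  [/\ inc_dinv a * inc_diag a = 1, inc_diag a * inc_dinv a = 1
    & inc_nil a ^+ #|P| = 0].
Proof.
move=> /forallP ua; split.
- by apply: diag_mul => s; rewrite mulVr.
- by apply: diag_mul => s; rewrite divrr.
apply: incP => s t _; rewrite inc_zeroE nil_pow ?max_card // => w.
rewrite inc_addE inc_oppE inc_oneE eqxx inc_mul_diag diagE eqxx mulVr //.
by rewrite subrr.
Qed.

Let inc_geom a : a \in inc_unit ->
  (\sum_(k < #|P|) inc_nil a ^+ k) * (inc_dinv a * a) = 1 /\
  (inc_dinv a * a) * (\sum_(k < #|P|) inc_nil a ^+ k) = 1.
Proof.
move=> /inc_unitE[_ _ N0].
have -> : inc_dinv a * a = 1 - inc_nil a by rewrite opprB addrC subrK.
have geomr : (1 - inc_nil a) * (\sum_(k < #|P|) inc_nil a ^+ k) = 1.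
  by rewrite -opprB mulNr -subrX1 N0 sub0r opprK.
split=> //; rewrite -[RHS]geomr; apply: commr_sym.
apply: commr_sum => k _; apply: commrX.
by apply: commr_sym; apply: commrB; [exact: commr1|].
Qed.

Fact inc_mulVr : {in inc_unit, left_inverse 1 inc_inv *%R}.
Proof.
move=> a ua; rewrite /inc_inv ua -mulrA.
by have [] := inc_geom ua.
Qed.

Fact inc_divrr : {in inc_unit, right_inverse 1 inc_inv *%R}.
Proof.
move=> a ua; rewrite /inc_inv ua; have [_ geomr] := inc_geom ua.
have [_ DD' _] := inc_unitE ua.
rewrite -[X in X * _]mul1r -[X in X * _ * _]DD' -!mulrA.
set S := \sum_(k < _) _.
have -> : inc_dinv a * (a * (S * inc_dinv a)) = inc_dinv a * a * S * inc_dinv a.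
  by rewrite !mulrA.
by rewrite geomr mul1r.
Qed.

Fact inc_unitP a b : b * a = 1 /\ a * b = 1 -> a \in inc_unit.
Proof.
move=> [ba1 ab1]; apply/forallP=> s; apply/unitrP; exists (b s s).
by rewrite -!inc_mul_diag ba1 ab1 inc_oneE eqxx.
Qed.

Fact inc_inv_out : {in [predC inc_unit], inc_inv =1 id}.
Proof. by move=> a; rewrite inE /= /inc_inv => /negPf->. Qed.

HB.instance Definition _ := GRing.NzRing_hasMulInverse.Build (incidence P R)
  inc_mulVr inc_divrr inc_unitP inc_inv_out.

Lemma inc_unitrE a :
  (a \is a GRing.unit) = [forall s : P, a s s \is a GRing.unit].
Proof. by []. Qed.

End IncidenceRing.

Section Chow.
Context {d : Order.disp_t} (P : finTBPOrderType d).

Definition zeta : incidence P int := inc_of (fun _ _ => 1).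

Definition moebius : incidence P int := zeta^-1.

Definition eulerian : Prop :=
  graded P /\
  forall s t : P, (s <= t)%O -> moebius s t = (-1) ^+ rk_itv s t.

Definition epsbar : incidence P {poly int} :=
  inc_of (fun s t => if s == t then -1 else ('X - 1) ^+ (rk_itv s t).-1).

Definition chow_function : incidence P {poly int} := - epsbar^-1.

Definition chow_poly : {poly int} := chow_function \bot%O \top%O.

Lemma zeta_unit : zeta \is a GRing.unit.
Proof. by rewrite inc_unitrE; apply/forallP=> s; rewrite inc_ofE lexx unitr1. Qed.

Lemma epsbar_unit : epsbar \is a GRing.unit.
Proof.
by rewrite inc_unitrE; apply/forallP=> s; rewrite inc_ofE lexx eqxx unitrN1.
Qed.

End Chow.

Section IntervalPoset.
Context {d : Order.disp_t} (P : finTBPOrderType d).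

Definition is_itv (A : {set P}) : bool :=
  (A == set0) ||
  [exists s : P, exists t : P,
    (s <= t)%O && (A == [set x | (s <= x <= t)%O])].

Record itv_poset := ItvPoset { itv_set : {set P}; _ : is_itv itv_set }.

HB.instance Definition _ := [isSub for itv_set].
HB.instance Definition _ := [Finite of itv_poset by <:].

Definition itv_le (A B : itv_poset) : bool := itv_set B \subset itv_set A.

Fact itv_le_refl : reflexive itv_le.
Proof. by move=> A; apply: subxx. Qed.

Fact itv_le_anti : antisymmetric itv_le.
Proof.
by move=> A B; rewrite andbC => AB; apply/val_inj/eqP; rewrite eqEsubset.
Qed.

Fact itv_le_trans : transitive itv_le.
Proof. by move=> B A C AB BC; apply: subset_trans BC AB. Qed.

Fact itv_display : Order.disp_t. Proof. exact: (Order.Disp tt tt). Qed.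

HB.instance Definition _ := Order.Le_isPOrder.Build itv_display itv_poset
  itv_le_refl itv_le_anti itv_le_trans.

Fact itv_full_subproof : is_itv [set: P].
Proof.
apply/orP; right; apply/existsP; exists \bot%O; apply/existsP; exists \top%O.
by rewrite le0x; apply/eqP/setP=> x; rewrite !inE le0x lex1.
Qed.

Fact itv_empty_subproof : is_itv set0.
Proof. by rewrite /is_itv eqxx. Qed.

Definition itv_full : itv_poset := ItvPoset itv_full_subproof.
Definition itv_empty : itv_poset := ItvPoset itv_empty_subproof.

Fact itv_full_le (A : itv_poset) : (itv_full <= A)%O.
Proof. exact: subsetT. Qed.

Fact itv_le_empty (A : itv_poset) : (A <= itv_empty)%O.
Proof. exact: sub0set. Qed.

HB.instance Definition _ :=
  Order.hasBottom.Build itv_display itv_poset itv_full_le.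
HB.instance Definition _ :=
  Order.hasTop.Build itv_display itv_poset itv_le_empty.

End IntervalPoset.

Section Veronese.
Implicit Types (h g : {poly int}) (a : nat -> int).

(* The identity [\sum_n a n x^n = h(x) / (1 - x)^k] of formal power series,
   with the denominator cleared and coefficients compared. *)
Definition gen_series h (k : nat) a : Prop :=
  forall n, \sum_(i < n.+1) ((1 - 'X : {poly int}) ^+ k)`_i * a (n - i)%N = h`_n.

(* [g] is the [m]-th Veronese transform of [h] with respect to degree [deg];
   it is unique by [is_veronese_uniq] below. *)
Definition is_veronese (m deg : nat) h g : Prop :=
  [/\ (size h <= deg.+1)%N, (size g <= deg.+1)%N
    & exists2 a, gen_series h deg.+1 a
               & gen_series g deg.+1 (fun n => a (m * n)%N)].

Lemma gen_series_inj h k a b : gen_series h k a -> gen_series h k b -> a =1 b.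
Proof.
move=> ha hb n; elim/ltn_ind: n => n IHn.
have := ha n; rewrite -(hb n) !big_ord_recl subn0.
have -> : ((1 - 'X : {poly int}) ^+ k)`_0 = 1.
  by rewrite -horner_coef0 horner_exp !hornerE expr1n.
rewrite !mul1r; under eq_bigr => i _.
  rewrite IHn; last by rewrite ltn_subrL /= (leq_ltn_trans _ (ltn_ord i)).
  over.
exact: addIr.
Qed.

Lemma is_veronese_uniq m deg h g g' :
  is_veronese m deg h g -> is_veronese m deg h g' -> g = g'.
Proof.
move=> [_ _ [a ha ga]] [_ _ [b hb g'b]]; apply/polyP=> n.
rewrite -(ga n) -(g'b n); apply: eq_bigr => i _.
by rewrite (gen_series_inj ha hb).
Qed.

End Veronese.

(* Main.v *)
Require Import Defs.
From HB Require Import structures.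
From mathcomp Require Import all_boot all_order all_algebra.
From mathcomp Require Import ring.

(** Let [r] be the rank of [P], [z] its zeta function, [mu = z^-1] its Moebius
    function and [N = z - 1], so that the entry of [N ^+ k] at the pair
    [(\bot, \top)], called [c_k] here, counts the strict chains of length [k]
    from bottom to top.  Expanding the inverse of [epsbar] over chains, the
    exponents [rho - 1] telescope, and the Chow polynomial is
    [H = \sum_k c_k (x - 1)^(r - k)] (lemma [chow_polyE]).

    Dividing by [(1 - x)^(r + 1)] turns [H] into the geometric series of
    [1 / (z - x) = \sum_n mu^(n + 1) x^n], up to the sign [(-1)^r]: in
    [chow_poly_series], the coefficient [a_n] of [H / (1 - x)^(r + 1)] is
    [(-1)^r] times the bottom-to-top entry of [mu^(n + 1)].  For an Eulerian
    poset [mu] is [z] up to the signs [(-1)^rho], and [a_n] is the number of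
    multichains of length [n + 1] from bottom to top.

    Multichains explain the doubling.  A multichain of [n + 1] steps from the
    full interval to the empty set in the poset of intervals whose last
    nonempty member is in position [n] is a nested sequence
    [[s_1, t_1] >= ... >= [s_n, t_n]], that is, a multichain
    [s_1 <= ... <= s_n <= t_n <= ... <= t_1], which has [2n + 1] steps in [P].
    The same relation holds for negative powers (lemma [moebius_itv]):
    the difference of the entries of [muh^n] and [muh^(n + 1)], where [muh] is
    the Moebius function of the interval poset, is the entry of [mu^(2n + 1)].
    As the interval poset has rank [r + 1] (lemma [poset_rank_itv]), the series
    of its Chow polynomial has denominator [(1 - x)^(r + 2)]; one factor
    [1 - x] takes the successive differences, which are the [a_(2n)]. This is
    the Veronese transform.

    Conversely the second Veronese transform is injective on polynomials of
    degree at most [d] (lemma [veronese2_inj]): if the even coefficients of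
    [h / (1 - x)^(d + 1)] vanish then this series is odd, so
    [h(x) (1 + x)^(d + 1) = - h(-x) (1 - x)^(d + 1)]; by coprimality
    [(1 - x)^(d + 1)] divides [h], which must be zero. *)

Set Implicit Arguments.
Unset Strict Implicit.
Unset Printing Implicit Defensive.

Import Order.TTheory GRing.Theory.
Local Open Scope ring_scope.

(** * Generating series *)

Section Series.
Implicit Types (h g : {poly int}) (a b : nat -> int).

(** The coefficient [n] of a product only sees the coefficients up to [n] of the
    factors, so power series can be replaced by their truncations. *)
Lemma gen_seriesP h k a :
  gen_series h k a <->
  forall n, ((1 - 'X) ^+ k * \poly_(i < n.+1) a i)`_n = h`_n.
Proof.
have coefE n : ((1 - 'X : {poly int}) ^+ k * \poly_(i < n.+1) a i)`_n =
    \sum_(i < n.+1) ((1 - 'X : {poly int}) ^+ k)`_i * a (n - i)%N.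
  rewrite coefM; apply: eq_bigr => i _.
  by rewrite coef_poly ltnS leq_subr.
by split=> ha n; rewrite -(ha n) coefE.
Qed.

Lemma gen_series_mod h k a n : gen_series h k a ->
  exists q, h = (1 - 'X) ^+ k * (\poly_(i < n) a i) + q * 'X^n.
Proof.
move=> ha; pose e := h - (1 - 'X) ^+ k * \poly_(i < n) a i.
exists (drop_poly n e); suff take0 : take_poly n e = 0.
  by rewrite -[X in _ + X]add0r -take0 poly_take_drop addrC subrK.
apply/polyP => i; rewrite coef_take_poly coef0; case: ltnP => // lt_in.
rewrite coefB -(ha i) coefM; apply/eqP; rewrite subr_eq0; apply/eqP.
apply: eq_bigr => j _; rewrite coef_poly ifT //.
by rewrite (leq_ltn_trans (leq_subr _ _)).
Qed.

Lemma gen_series_sub h g k a b : gen_series h k a -> gen_series g k b ->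
  gen_series (h - g) k (fun n => a n - b n).
Proof.
move=> ha gb n; rewrite coefB -ha -gb -sumrB.
by apply: eq_bigr => i _; rewrite mulrBr.
Qed.

(** Multiplying a power series by [1 - x] takes the successive differences of
    its coefficients. *)
Lemma gen_series_diff h k a b : gen_series h k.+1 a ->
  b 0%N = a 0%N -> (forall n, b n.+1 = a n.+1 - a n) -> gen_series h k b.
Proof.
move=> /gen_seriesP ha b0 bS; apply/gen_seriesP => n; rewrite -ha.
have -> : \poly_(i < n.+1) b i =
    (1 - 'X) * (\poly_(i < n.+1) a i) + (a n)%:P * 'X^(n.+1).
  apply/polyP => i; rewrite mulrBl mul1r coefD coefB coefXM coefCM coefXn.
  rewrite !coef_poly; case: (ltngtP i n.+1) => [lt_in|lt_ni|->] /=.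
  - rewrite mulr0 addr0; case: i lt_in => [|i] lt_in; first by rewrite subr0.
    by rewrite bS ltnW.
  - rewrite mulr0 addr0; case: i lt_ni => //= i lt_ni.
    by rewrite [(i < n.+1)%N]ltnNge -ltnS lt_ni /= subrr.
  - by rewrite ltnSn mulr1 sub0r addNr.
by rewrite mulrDr mulrA -exprSr coefD (mulrA _ (a n)%:P) coefMXn ltnSn addr0.
Qed.

(** A series with zero even part is odd; comparing [h(x) / (1 - x)^(d+1)] with
    its image under [x |-> - x] shows that [(1 - x)^(d+1)] divides [h], whose
    degree is too small. *)
Lemma gen_series_even0 h d a : (size h <= d.+1)%N -> gen_series h d.+1 a ->
  (forall n, a (2 * n)%N = 0) -> h = 0.
Proof.
move=> hsz ha a0; apply/eqP/contraT => h0.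
pose A n := \poly_(i < n) a i.
have AN n : A n \Po (- 'X) = - A n.
  apply/polyP => i; rewrite -[- 'X]scaleN1r coef_comp_poly.
  have E j : ((-1) *: 'X : {poly int}) ^+ j = (-1) ^+ j *: 'X^j.
    by rewrite exprZn.
  under eq_bigr do rewrite E coefZ coefXn.
  rewrite coefN.
  have [lt_i|le_i] := ltnP i (size (A n)); last first.
    rewrite nth_default // oppr0 big1 // => j _.
    by rewrite gtn_eqF ?(leq_trans _ le_i) // !mulr0.
  rewrite (bigD1 (Ordinal lt_i)) //= eqxx mulr1 big1 ?addr0; last first.
    by move=> j; rewrite -val_eqE /= eq_sym => /negPf->; rewrite !mulr0.
  rewrite coef_poly; case: ifP => // _; last by rewrite mul0r oppr0.
  rewrite -signr_odd; case: (boolP (odd i)) => [_|/negPf odd_i].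
    by rewrite expr1 mulrN1.
  by rewrite -[i]odd_double_half odd_i -mul2n a0 mul0r oppr0.
(* Modulo [x^(n+1)], [h] is [(1 - x)^(d+1) * A n.+1], and [A n.+1] is odd by
   [AN]; so the coefficient [n] vanishes, for every [n]. *)
have key : h * ('X + 1) ^+ d.+1 + (h \Po (- 'X)) * (1 - 'X) ^+ d.+1 = 0.
  apply/polyP => n; have [q hq] := gen_series_mod n.+1 ha.
  rewrite coef0 {2}hq comp_polyD !comp_polyM AN !rmorphXn /= comp_polyB.
  rewrite comp_polyC comp_polyX opprK.
  set u := (_ + 1) ^+ _; rewrite [1 + 'X]addrC -/u {1}hq.
  set v := (1 - 'X) ^+ _; rewrite !mulrDl.
  rewrite [(- 'X) ^+ _]exprNn -/(A n.+1).
  rewrite (_ : _ + _ = (q * u + (q \Po - 'X) * (-1) ^+ n.+1 * v) * 'X^(n.+1)).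
    by rewrite coefMXn ltnSn.
  ring.
have dvd_h : ('X - 1%:P) ^+ d.+1 %| h.
  have cop : coprimep (('X - 1%:P : {poly int}) ^+ d.+1) (('X + 1) ^+ d.+1).
    apply/coprimep_expl/coprimep_expr.
    have -> : 'X + 1 = 'X - (-1)%:P :> {poly int} by rewrite polyCN opprK.
    exact: coprimep_XsubC2.
  rewrite -(Gauss_dvdpl _ cop).
  move/eqP: key; rewrite addr_eq0 => /eqP->.
  by rewrite -(opprB 'X 1) exprNn mulrA -mulNr polyC1 dvdp_mull.
move: (dvdp_leq h0 dvd_h); rewrite size_exp_XsubC => lt_dh.
by move: (leq_trans lt_dh hsz); rewrite ltnn.
Qed.

Lemma veronese2_inj d h1 h2 g :
  is_veronese 2 d h1 g -> is_veronese 2 d h2 g -> h1 = h2.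
Proof.
move=> [sz1 _ [a1 ha1 ga1]] [sz2 _ [a2 ha2 ga2]].
apply/eqP; rewrite -subr_eq0; apply/eqP.
apply: (gen_series_even0 (d := d) _ (gen_series_sub ha1 ha2)).
  by rewrite (leq_trans (size_polyD _ _)) // size_polyN geq_max sz1.
by move=> n; rewrite (gen_series_inj ga1 ga2) subrr.
Qed.

End Series.

(** * Ranks *)

Section Rank.
Context {d : Order.disp_t} (P : finTBPOrderType d).
Implicit Types (s t : P) (C : {set P}).

Lemma rk_ge_chain C t : is_chain C -> (forall x, x \in C -> (x <= t)%O) ->
  (#|C| <= (rk t).+1)%N.
Proof.
move=> chC Ct; apply: leq_trans (leqSpred _).
apply: (leq_bigmax_cond (P := fun C : {set P} =>
  is_chain C && [forall x in C, (x <= t)%O])).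
by rewrite chC; apply/forall_inP.
Qed.

Lemma rk_chainP t : exists C, [/\ is_chain C,
  forall x, x \in C -> (x <= t)%O & #|C| = (rk t).+1].
Proof.
pose p C := is_chain C && [forall x in C, (x <= t)%O].
have p1 : p [set t].
  apply/andP; split; last by apply/forall_inP => x /set1P ->.
  apply/forall_inP => x /set1P ->; apply/forall_inP => y /set1P ->.
  exact: comparablexx.
have p_gt0 : (0 < #|p|)%N by apply/card_gt0P; exists [set t].
have [C /andP[chC /forall_inP Ct] maxC] := eq_bigmax_cond (fun C => #|C|) p_gt0.
exists C; split=> //; rewrite /rk -maxC prednK // maxC.
have := leq_bigmax_cond (F := fun C : {set P} => #|C|) _ p1.
rewrite cards1 => /leq_trans; apply; apply: eq_leq; exact: maxC.
Qed.

Lemma rk_ltn s t : (s < t)%O -> (rk s < rk t)%N.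
Proof.
move=> lt_st; have [C [chC Cs szC]] := rk_chainP s.
have tC : t \notin C by apply/negP => /Cs /(lt_le_trans lt_st); rewrite ltxx.
have: (#|t |: C| <= (rk t).+1)%N.
  apply: rk_ge_chain => [|x]; last first.
    by case/setU1P => [->//|/Cs /le_lt_trans/(_ lt_st)/ltW].
  have Ct x : x \in C -> (x <= t)%O by move/Cs/le_lt_trans/(_ lt_st)/ltW.
  apply/forall_inP => x /setU1P[->|xC]; apply/forall_inP => y /setU1P[->|yC].
  - exact: comparablexx.
  - by rewrite /Order.comparable (Ct y) ?orbT.
  - by rewrite /Order.comparable (Ct x).
  - by move/forall_inP/(_ x xC)/forall_inP/(_ y yC): chC.
by rewrite cardsU1 tC szC.
Qed.

Lemma rk_leq s t : (s <= t)%O -> (rk s <= rk t)%N.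
Proof. by rewrite le_eqVlt => /predU1P[->//|/rk_ltn/ltnW]. Qed.

(** The values of [f] along a chain that ends below [t] are distinct and at most
    [f t].  This is the tool to bound a rank from above. *)
Lemma rk_leq_mono (f : P -> nat) t :
  {homo f : x y / (x < y)%O >-> (x < y)%N} -> (rk t <= f t)%N.
Proof.
move=> fmono; have [C [chC Ct szC]] := rk_chainP t.
have fle x : x \in C -> (f x < (f t).+1)%N.
  by move/Ct; rewrite le_eqVlt ltnS => /predU1P[->//|/fmono/ltnW].
have finj : {in C &, injective (fun x => inord (f x) : 'I_(f t).+1)}.
  move=> x y xC yC /(congr1 val); rewrite /= !inordK ?fle // => fxy.
  move/forall_inP/(_ x xC)/forall_inP/(_ y yC): chC.
  rewrite /Order.comparable !le_eqVlt => /orP[] /predU1P[//|/fmono];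
    by rewrite fxy ltnn.
rewrite -ltnS -szC -(card_in_imset finj).
by apply: leq_trans (max_card _) _; rewrite card_ord.
Qed.

Lemma rk_bot : rk (\bot%O : P) = 0%N.
Proof.
have [C [_ Cb szC]] := rk_chainP (\bot%O : P).
apply/eqP; rewrite -leqn0 -ltnS -szC -(cards1 (\bot%O : P)) subset_leq_card //.
by apply/subsetP => x /Cb; rewrite lex0 inE.
Qed.

End Rank.
(** * Incidence algebras *)

Section IncidenceAlgebra.
Context {d : Order.disp_t} (P : finTBPOrderType d) (R : comUnitRingType).
Implicit Types (a b : incidence P R) (f : P -> R) (s t : P).

Lemma inc_mul_sumE a b s t : (a * b) s t = \sum_w a s w * b w t.
Proof. exact: inc_mulE_. Qed.

Lemma inc_subE a b s t : (a - b) s t = a s t - b s t.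
Proof. by rewrite inc_addE inc_oppE. Qed.

Lemma inc_sumE I (r : seq I) (p : pred I) (F : I -> incidence P R) s t :
  (\sum_(i <- r | p i) F i) s t = \sum_(i <- r | p i) F i s t.
Proof.
by apply: (big_morph (fun a => a s t)) => [a b|]; rewrite (inc_addE, inc_zeroE).
Qed.

Definition inc_diag f : incidence P R := inc_of (fun s t => f s *+ (s == t)).

Lemma inc_diagE f s t : inc_diag f s t = f s *+ (s == t).
Proof.
by rewrite inc_ofE; case: eqVneq => [->|_]; rewrite ?lexx // mulr0n if_same.
Qed.

Lemma inc_diag_mull f a s t : (inc_diag f * a) s t = f s * a s t.
Proof.
rewrite inc_mul_sumE (bigD1 s) //= inc_diagE eqxx big1 ?addr0 // => w.
by rewrite eq_sym inc_diagE => /negPf->; rewrite mul0r.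
Qed.

Lemma inc_diag_mulr f a s t : (a * inc_diag f) s t = a s t * f t.
Proof.
rewrite inc_mul_sumE (bigD1 t) //= inc_diagE eqxx big1 ?addr0 // => w.
by rewrite inc_diagE => /negPf->; rewrite mulr0.
Qed.

(** The scalar [c] as an element of the incidence ring; it lets
    noncommutative identities in powers of [x] and zeta be written in one
    ring. *)
Definition inc_scalar (c : R) : incidence P R := inc_diag (fun=> c).

Lemma inc_scalarE c s t : inc_scalar c s t = c *+ (s == t).
Proof. exact: inc_diagE. Qed.

Fact inc_scalar_is_zmod_morphism : zmod_morphism inc_scalar.
Proof.
by move=> c e; apply: incP => s t _; rewrite inc_subE !inc_scalarE mulrnBl.
Qed.

Fact inc_scalar_is_monoid_morphism : monoid_morphism inc_scalar.
Proof.
split=> [|c e]; apply: incP => s t _.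
  exact: etrans (inc_scalarE _ _ _) (esym (inc_oneE _ _ _)).
by rewrite inc_diag_mull !inc_scalarE mulrnAr.
Qed.

HB.instance Definition _ := GRing.isZmodMorphism.Build R (incidence P R)
  inc_scalar inc_scalar_is_zmod_morphism.
HB.instance Definition _ := GRing.isMonoidMorphism.Build R (incidence P R)
  inc_scalar inc_scalar_is_monoid_morphism.

Lemma inc_scalar_mulE c a s t : (inc_scalar c * a) s t = c * a s t.
Proof. exact: inc_diag_mull. Qed.

Lemma inc_scalar_comm c a : GRing.comm (inc_scalar c) a.
Proof.
by apply: incP => s t _; rewrite inc_diag_mull inc_diag_mulr mulrC.
Qed.

End IncidenceAlgebra.

Section IncidenceMap.
Context {d : Order.disp_t} (P : finTBPOrderType d).
Context (R S : comUnitRingType) (f : {rmorphism R -> S}).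

Definition inc_map (a : incidence P R) : incidence P S :=
  inc_of (fun s t => f (a s t)).

Lemma inc_mapE a s t : inc_map a s t = f (a s t).
Proof. by rewrite inc_ofE; case: ifPn => // /inc_eq0->; rewrite rmorph0. Qed.

Fact inc_map_is_zmod_morphism : zmod_morphism inc_map.
Proof.
move=> a b; apply: incP => s t _.
by rewrite inc_subE !inc_mapE inc_subE rmorphB.
Qed.

Fact inc_map_is_monoid_morphism : monoid_morphism inc_map.
Proof.
split=> [|a b]; apply: incP => s t _; rewrite inc_mapE.
  by rewrite !inc_oneE rmorph_nat.
rewrite !inc_mul_sumE rmorph_sum; apply: eq_bigr => w _.
by rewrite rmorphM !inc_mapE.
Qed.

HB.instance Definition _ := GRing.isZmodMorphism.Build
  (incidence P R) (incidence P S) inc_map inc_map_is_zmod_morphism.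
HB.instance Definition _ := GRing.isMonoidMorphism.Build
  (incidence P R) (incidence P S) inc_map inc_map_is_monoid_morphism.

End IncidenceMap.

(** * Chow polynomials and negative powers of zeta *)

Section ChowSeries.
Context {d : Order.disp_t} (P : finTBPOrderType d).
Implicit Types s t : P.

Lemma zetaE s t : zeta P s t = (s <= t)%O%:R.
Proof. by rewrite inc_ofE; case: ifP. Qed.

Lemma zetaV : zeta P * moebius P = 1.
Proof. by rewrite divrr // zeta_unit. Qed.

Lemma moebiusV : moebius P * zeta P = 1.
Proof. by rewrite mulVr // zeta_unit. Qed.

Lemma strict_zetaE s t : (zeta P - 1) s t = (s < t)%O%:R.
Proof.
rewrite inc_subE inc_oneE zetaE lt_neqAle.
by case: eqVneq => [->|_]; rewrite ?lexx ?subrr // subr0.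
Qed.

Lemma strict_zeta_nilp k s t : (rk t < rk s + k)%N ->
  ((zeta P - 1) ^+ k) s t = 0.
Proof.
elim: k s => [|k IHk] s.
  rewrite addn0 => lt_ts; apply: inc_eq0; apply: contraL lt_ts.
  by move/rk_leq; rewrite leqNgt.
move=> lt_ts; rewrite exprS inc_mul_sumE big1 // => w _.
rewrite strict_zetaE; have [/rk_ltn lt_sw|_] := boolP (s < w)%O.
  rewrite IHk ?mulr0 // (leq_trans lt_ts) // addnS -addSn leq_add2r //.
by rewrite mul0r.
Qed.

(* [T] is the homogenized geometric sum of [N] and [y = x - 1]: it satisfies
   [(y - N) T = y^(r+1)] because [N ^+ r.+1 = 0]: a
   strict chain has at most [r] steps. *)
Let r := poset_rank P.
Let y : incidence P {poly int} := inc_scalar P ('X - 1).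
Let N : incidence P {poly int} := inc_map polyC (zeta P - 1).
Let T : incidence P {poly int} := \sum_(k < r.+1) y ^+ (r - k) * N ^+ k.

Let comm_yN : GRing.comm y N. Proof. exact: inc_scalar_comm. Qed.

Let mulT : (y - N) * T = y ^+ r.+1.
Proof.
suff N0 : N ^+ r.+1 = 0 by rewrite -(subrXX_comm r.+1 comm_yN) N0 subr0.
rewrite -rmorphXn; apply: incP => s t _; rewrite inc_zeroE inc_mapE.
rewrite strict_zeta_nilp ?polyC0 //.
by rewrite addnS ltnS (leq_trans (rk_leq (lex1 t))) ?leq_addl.
Qed.

Let comm_T a : GRing.comm a N -> GRing.comm a T.
Proof.
move=> aN; apply: commr_sum => k _; apply: commrM; last exact: commrX.
by apply: commrX; apply: commr_sym; apply: inc_scalar_comm.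
Qed.

Let comm_TyN : GRing.comm T (y - N).
Proof.
apply/commr_sym/comm_T/commr_sym/commrB => //.
Qed.

Let TE s t :
  T s t = \sum_(k < r.+1) ('X - 1) ^+ (r - k) * (((zeta P - 1) ^+ k) s t)%:P.
Proof.
rewrite inc_sumE; apply: eq_bigr => k _.
by rewrite -!rmorphXn inc_scalar_mulE inc_mapE.
Qed.

(* Conjugation by the diagonal [(x - 1)^rk] absorbs the exponents of
   [epsbar], up to one factor [x - 1] per step: the off-diagonal part of
   [epsbar], scaled by [x - 1], is conjugate to [N]. *)
Let epsbar_conj :
  N * inc_diag (fun s => ('X - 1) ^+ rk s) =
  y * inc_diag (fun s => ('X - 1) ^+ rk s) * (epsbar P + 1).
Proof.
apply: incP => s t le_st; rewrite inc_diag_mulr -mulrA inc_scalar_mulE.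
rewrite inc_diag_mull inc_mapE strict_zetaE inc_addE inc_oneE inc_ofE le_st.
case: eqVneq => [->|neq_st]; first by rewrite ltxx addNr !mulr0 mul0r.
have lt_st : (s < t)%O by rewrite lt_neqAle neq_st.
rewrite lt_st mul1r addr0 mulrA -exprS -exprD addSnnS prednK; last first.
  by rewrite subn_gt0 rk_ltn.
by rewrite subnKC // ltnW // rk_ltn.
Qed.

(** By [epsbar_conj], [y - N] is conjugate to [- y * epsbar], so [T], which is
    the inverse of [y - N] up to [y^(r+1)], is conjugate to the Chow function up
    to a power of [x - 1]; at the pair [(\bot, \top)] the powers cancel. *)
Lemma chow_polyE : chow_poly P = \sum_(k < r.+1)
  ('X - 1) ^+ (r - k) * (((zeta P - 1) ^+ k) \bot%O \top%O)%:P.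
Proof.
rewrite -TE /chow_poly.
pose D := inc_diag (fun s : P => ('X - 1 : {poly int}) ^+ rk s).
have yND : (y - N) * D = - (y * D * epsbar P).
  by rewrite mulrBl epsbar_conj -/D mulrDr mulr1 opprD addrCA subrr addr0.
have comm_yNT : T * (y - N) = (y - N) * T.
  exact: comm_TyN.
have : y ^+ r.+1 * D * chow_function P = y * T * D.
  rewrite -mulT -comm_yNT -[T * _ * D]mulrA yND.
  rewrite /chow_function !mulrN mulNr opprK !mulrA mulrK ?epsbar_unit //.
  by rewrite [y * T](inc_scalar_comm _ T).
move/(congr1 (fun a : incidence P {poly int} => a \bot%O \top%O)).
rewrite inc_diag_mulr -!mulrA -rmorphXn !inc_scalar_mulE inc_diag_mull rk_bot.
rewrite expr0 mul1r -/(poset_rank P) -/r mulrAC -exprS.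
by apply: mulfI; rewrite expf_neq0 // polyXsubC_eq0.
Qed.

(** Since [z - x = N - y], the identity [T (y - N) = y^(r+1)] reads
    [T (x - z) = (x - 1)^(r+1)], and [1 / (z - x)] expands as
    [\sum_n mu^(n+1) x^n], here truncated at order [n]. *)
Lemma chow_poly_series : gen_series (chow_poly P) r.+1
  (fun n => (-1) ^+ r * (moebius P ^+ n.+1) \bot%O \top%O).
Proof.
apply/gen_seriesP => n; rewrite chow_polyE -TE.
pose x : incidence P {poly int} := inc_scalar P 'X.
pose mu : incidence P {poly int} := inc_map polyC (moebius P).
pose z : incidence P {poly int} := inc_map polyC (zeta P).
have zmu : z * mu = 1 by rewrite -rmorphM zetaV rmorph1.
have mulTz : T * (x - z) = y ^+ r.+1.
  rewrite -mulT -comm_TyN; congr (T * _).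
  by rewrite /y /N !rmorphB !rmorph1 opprB addrA subrK.
pose w := x * mu; pose S := (\sum_(i < n.+1) w ^+ i) * mu.
have wE i : w ^+ i = x ^+ i * mu ^+ i.
  by rewrite exprMn_comm //; apply: inc_scalar_comm.
have mulzS : (x - z) * S = x ^+ n.+1 * mu ^+ n.+1 - 1.
  have -> : x - z = z * (w - 1).
    by rewrite mulrBr mulr1 /w [x * mu](inc_scalar_comm _ mu) mulrA zmu mul1r.
  rewrite mulrA -[z * _ * _]mulrA -subrX1 mulrBr mulr1 mulrBl zmu -wE.
  have -> : z * w ^+ n.+1 * mu = z * (mu * w ^+ n.+1).
    rewrite -mulrA; congr (z * _); apply/commr_sym/commrX/commrM => //.
    exact/commr_sym/inc_scalar_comm.
  by rewrite mulrA zmu mul1r.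
have : y ^+ r.+1 * S = x ^+ n.+1 * (T * mu ^+ n.+1) - T.
  rewrite -mulTz -mulrA mulzS mulrBr mulr1 !mulrA; congr (_ * _ - _).
  by apply: commrX; apply/commr_sym/inc_scalar_comm.
move/(congr1 (fun a : incidence P {poly int} => a \bot%O \top%O)).
rewrite inc_subE -!rmorphXn !inc_scalar_mulE.
move/(congr1 (fun p : {poly int} => - p`_n)); rewrite /= coefB coefXnM.
rewrite ltnSn sub0r opprK => <-; rewrite -coefN.
congr (_`_n); rewrite -mulNr; apply/esym.
have -> : S \bot%O \top%O =
    \poly_(i < n.+1) (moebius P ^+ i.+1) \bot%O \top%O.
  rewrite /S mulr_suml inc_sumE poly_def; apply: eq_bigr => i _.
  by rewrite wE -mulrA -exprSr -!rmorphXn inc_scalar_mulE inc_mapE mulrC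
    mul_polyC.
set Y := 'X - 1; set p := \poly_(i < n.+1) _.
have -> : \poly_(i < n.+1) ((-1) ^+ r * (moebius P ^+ i.+1) \bot%O \top%O)
    = (-1) ^+ r * p.
  apply/polyP => i; rewrite -polyC1 -polyCN -polyC_exp coefCM !coef_poly.
  by case: ifP; rewrite ?mulr0.
rewrite -(opprB 'X 1) [(- ('X - 1)) ^+ _]exprNn -/Y mulrACA -exprD.
rewrite addSn addnn [(-1) ^+ _]exprS -mul2n exprM.
by rewrite sqrrN !expr1n mulr1 mulN1r mulNr.
Qed.

(** The term [k = 0], of degree [r], is the entry of the identity, which
    vanishes unless bottom and top coincide. *)
Lemma size_chow_poly : (size (chow_poly P) <= maxn 1 r)%N.
Proof.
rewrite chow_polyE; apply: (leq_trans (size_sum _ _ _)).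
apply/bigmax_leqP => k _; rewrite mulrC mul_polyC.
have size_term (c : int) :
    (size (c *: ('X - 1 : {poly int}) ^+ (r - k)) <= (r - k).+1)%N.
  by rewrite (leq_trans (size_scale_leq _ _)) // size_exp_XsubC.
have [k0|k_gt0] := posnP k; last first.
  apply: leq_trans (size_term _) _; move: (nat_of_ord k) k_gt0 => [//|j] _.
  by rewrite leq_max; case: (r) => [|m]; rewrite ?subSS ?ltnS ?leq_subr ?orbT.
have [r0|r_gt0] := posnP r.
  apply: leq_trans (size_term _) _; rewrite leq_max ltnS.
  by rewrite (leq_trans (leq_subr k r)) // leqn0 r0.
rewrite k0 expr0 inc_oneE; case: eqP => [eq_bt|_]; last
  by rewrite scale0r size_poly0.
by move: r_gt0; rewrite /r /poset_rank -eq_bt rk_bot.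
Qed.

End ChowSeries.

(** * The poset of intervals *)

Section Intervals.
Context {d : Order.disp_t} (P : finTBPOrderType d).
Implicit Types (s t : P) (A B : itv_poset P) (f : incidence P int).

Fact itv_subproof s t : is_itv [set x | (s <= x <= t)%O].
Proof.
apply/orP; have [le_st|nle_st] := boolP (s <= t)%O.
  right; apply/existsP; exists s; apply/existsP; exists t.
  by rewrite le_st eqxx.
left; apply/eqP/setP => x; rewrite !inE; apply: contraNF nle_st.
by case/andP; apply: le_trans.
Qed.

(** Incomparable or reversed pairs give the empty set; an incidence function
    vanishes there, so sums over intervals become sums over all pairs. *)
Definition itv s t : itv_poset P := ItvPoset (itv_subproof s t).

Lemma mem_itv s t x : (x \in itv_set (itv s t)) = (s <= x <= t)%O.
Proof. by rewrite inE. Qed.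

Lemma itv_nle s t : ~~ (s <= t)%O -> itv s t = \top%O.
Proof.
move=> nle_st; apply/val_inj/setP => x; rewrite /= !inE.
by apply: contraNF nle_st => /andP[]; apply: le_trans.
Qed.

Lemma itv_neq_top s t : (s <= t)%O -> itv s t != \top%O.
Proof.
move=> le_st; apply/eqP => /(congr1 (fun A => s \in itv_set A)).
by rewrite mem_itv lexx le_st /= inE.
Qed.

Lemma itv_le_itv s t u v : (u <= v)%O ->
  (itv s t <= itv u v)%O = (s <= u)%O && (v <= t)%O.
Proof.
move=> le_uv; apply/subsetP/andP => [sub|[le_su le_vt] x].
  by have := sub u; have := sub v; rewrite !mem_itv !lexx !le_uv /=;
    move=> /(_ isT)/andP[_ ->] /(_ isT)/andP[->].
rewrite !mem_itv => /andP[le_ux le_xv].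
by rewrite (le_trans le_su) // (le_trans le_xv).
Qed.

Lemma itv_inj s t u v : (s <= t)%O -> (itv u v == itv s t) = ((u, v) == (s, t)).
Proof.
move=> le_st; apply/eqP/eqP => [eq_itv|[-> ->//]].
have le_uv : (u <= v)%O.
  apply: contraT => /itv_nle itv0.
  by move: (itv_neq_top le_st); rewrite -eq_itv itv0 eqxx.
have := lexx (itv s t); rewrite -{1}eq_itv itv_le_itv // => /andP[us tv].
have := lexx (itv u v); rewrite {1}eq_itv itv_le_itv // => /andP[su vt].
by congr (_, _); apply/le_anti; rewrite ?us ?su ?tv ?vt.
Qed.

Variant itv_spec A : Prop :=
  | ItvTop of A = \top%O
  | ItvPair s t of (s <= t)%O & A = itv s t.

Lemma itvP A : itv_spec A.
Proof.
have := valP A; rewrite /is_itv => /orP[/eqP A0|].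
  by left; apply: val_inj.
case/existsP => s /existsP[t /andP[le_st /eqP AE]].
by right with s t => //; apply: val_inj.
Qed.

Lemma itv_bot : itv \bot%O \top%O = \bot%O.
Proof. by apply/val_inj/setP => x; rewrite /= !inE le0x lex1. Qed.

Lemma big_itv (R : Type) (idx : R) (op : Monoid.com_law idx)
    (F : P -> P -> R) s t : (s <= t)%O ->
  \big[op/idx]_(p : P * P | itv p.1 p.2 == itv s t) F p.1 p.2 = F s t.
Proof.
move=> le_st; rewrite (big_pred1 (s, t)) // => -[u v].
by rewrite /= itv_inj.
Qed.

(** For the upper bound, [r + 1 - len] is strictly increasing on intervals,
    where [len [s, t] = rk t - rk s + 1].  For the lower bound, a longest
    chain [C] of [P] gives the chain of the [[s, \top]], for [s] in [C],
    followed by the empty set. *)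
Lemma poset_rank_itv : poset_rank (itv_poset P) = (poset_rank P).+1.
Proof.
apply/eqP; rewrite eqn_leq; apply/andP; split.
  (* The sum has at most one term; it avoids choosing endpoints for [A]. *)
  pose len A := \sum_(p : P * P | itv p.1 p.2 == A)
    (if (p.1 <= p.2)%O then (rk_itv p.1 p.2).+1 else 0)%N.
  have len_itv s t : (s <= t)%O -> len (itv s t) = (rk t - rk s).+1.
    move=> le_st; rewrite /len.
    pose F (u v : P) := if (u <= v)%O then (rk_itv u v).+1 else 0%N.
    rewrite (big_itv _ F) // /F.
    by rewrite le_st.
  have len_top : len \top%O = 0%N.
    rewrite /len big1 // => -[u v] /= /eqP itv_top.
    by case: ifPn => // /itv_neq_top; rewrite itv_top eqxx.
  have len_le A : (len A <= (poset_rank P).+1)%N.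
    case: (itvP A) => [->|s t le_st ->]; first by rewrite len_top.
    by rewrite len_itv // ltnS (leq_trans (leq_subr _ _)) // rk_leq ?lex1.
  rewrite -[X in (_ <= X)%N]subn0 -len_top.
  apply: (rk_leq_mono (f := fun A => ((poset_rank P).+1 - len A)%N)).
  move=> A B lt_AB.
  suff lt_len : (len B < len A)%N by rewrite ltn_sub2l // (leq_trans lt_len).
  case: (itvP A) lt_AB => [->|s t le_st ->]; first by rewrite lt1x.
  case: (itvP B) => [->|u v le_uv ->]; first by rewrite len_top len_itv.
  rewrite lt_neqAle itv_le_itv // !len_itv // ltnS => /and3P[neq le_su le_vt].
  have: (s < u)%O || (v < t)%O.
    rewrite !lt_neqAle le_su le_vt !andbT -negb_and.
    by apply: contra neq => /andP[/eqP-> /eqP->].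
  case/orP => /rk_ltn lt_rk.
    apply: leq_ltn_trans (leq_sub2r _ (rk_leq le_vt)) _.
    rewrite ltn_sub2l // (leq_trans lt_rk) //.
    by rewrite (leq_trans (rk_leq le_uv)) ?rk_leq.
  apply: leq_ltn_trans (leq_sub2l _ (rk_leq le_su)) _.
  rewrite ltn_sub2r // (leq_ltn_trans _ lt_rk) //.
  by rewrite (leq_trans (rk_leq le_su)) ?rk_leq.
have [C [chC _ szC]] := rk_chainP (\top%O : P).
pose D := itv_empty P |: [set itv s \top%O | s in C].
have inj : {in C &, injective (fun s => itv s \top%O)}.
  move=> s u _ _ /eqP; rewrite itv_inj ?lex1 //.
  by case/eqP.
have eD : itv_empty P \notin [set itv s \top%O | s in C].
  apply/negP => /imsetP[s _ /eqP]; rewrite eq_sym.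
  by apply/negP/itv_neq_top/lex1.
have szD : #|D| = (poset_rank P).+2 by rewrite cardsU1 eD card_in_imset // szC.
rewrite -ltnS -szD; apply: rk_ge_chain => [|A _]; last exact: lex1.
apply/forall_inP => A /setU1P[->|/imsetP[s sC ->]]; apply/forall_inP => B.
  by rewrite /Order.comparable lex1 orbT.
case/setU1P => [->|/imsetP[u uC ->]]; first by rewrite /Order.comparable lex1.
rewrite /Order.comparable !itv_le_itv ?lex1 // !andbT.
by move/forall_inP/(_ s sC)/forall_inP/(_ u uC): chC.
Qed.

Let zh := zeta (itv_poset P).
Let muh := moebius (itv_poset P).
Let z := zeta P.
Let mu := moebius P.

(** Values of [f] on the intervals, placed in the column of the empty set (the
    maximum of the interval poset) so that they can be multiplied by its
    incidence functions. *)
Definition itv_col f : incidence (itv_poset P) int :=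
  inc_of (fun A B =>
    (\sum_(p : P * P | itv p.1 p.2 == A) f p.1 p.2) *+ (B == \top%O)).

Lemma itv_colE f A B : itv_col f A B =
  (\sum_(p : P * P | itv p.1 p.2 == A) f p.1 p.2) *+ (B == \top%O).
Proof.
rewrite inc_ofE; case: eqVneq => [->|_]; first by rewrite lex1.
by rewrite if_same.
Qed.

Lemma itv_col_itv f s t : (s <= t)%O -> itv_col f (itv s t) \top%O = f s t.
Proof. by move=> le_st; rewrite itv_colE eqxx big_itv. Qed.

Lemma big_itv_top f : \sum_(p : P * P | itv p.1 p.2 == \top%O) f p.1 p.2 = 0.
Proof.
rewrite big1 // => -[s t] /= itv_top.
by apply: inc_eq0; apply: contraTN itv_top => /itv_neq_top.
Qed.

Lemma itv_col_top f B : itv_col f \top%O B = 0.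
Proof. by rewrite itv_colE big_itv_top mul0rn. Qed.

(** Summing [f] over the subintervals of [[s, t]] is multiplying it by zeta on
    both sides: the two endpoints move independently. *)
Lemma zeta_itv_col f : zh * itv_col f = itv_col (z * f * z).
Proof.
apply: incP => A B _; rewrite inc_mul_sumE itv_colE.
under eq_bigr do rewrite itv_colE mulrnAr.
rewrite sumrMnl; congr (_ *+ _).
transitivity (\sum_(p : P * P | (A <= itv p.1 p.2)%O) f p.1 p.2).
  rewrite (partition_big (fun p => itv p.1 p.2) (fun C => (A <= C)%O)) //=.
  rewrite [RHS]big_mkcond; apply: eq_bigr => C _; rewrite zetaE.
  case: ifP => [le_AC|_]; last by rewrite mul0r.
  rewrite mul1r; apply: eq_bigl => p.
  by case: eqP => [->|_]; rewrite ?le_AC ?andbF.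
case: (itvP A) => [->|s t le_st ->].
  under eq_bigl do rewrite le1x.
  by rewrite !big_itv_top.
rewrite (big_itv _ (z * f * z)) // inc_mul_sumE.
under [RHS]eq_bigr do rewrite inc_mul_sumE mulr_suml.
rewrite exchange_big pair_big big_mkcond /=; apply: eq_bigr => -[u v] _ /=.
rewrite !zetaE; have [le_uv|nle_uv] := boolP (u <= v)%O.
  by rewrite itv_le_itv //; case: (s <= u)%O; case: (v <= t)%O;
    rewrite ?mul1r ?mul0r ?mulr1 ?mulr0.
by rewrite (inc_eq0 f nle_uv) if_same mulr0 mul0r.
Qed.

Definition top_col : incidence (itv_poset P) int :=
  inc_diag (fun A => (A == \top%O)%:R).

(** Inverting [zeta_itv_col], [muh] acts on columns by [f |-> mu f mu].  For
    [n = 0], the column [(zh - 1) * top_col] is [1] on all nonempty intervals,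
    so it is [itv_col z]. *)
Lemma moebius_top_col n :
  muh ^+ n * (1 - muh) * top_col = itv_col (mu ^+ (2 * n).+1).
Proof.
have mu_col f : muh * itv_col f = itv_col (mu * f * mu).
  have -> : itv_col f = zh * itv_col (mu * f * mu).
    by rewrite zeta_itv_col !mulrA zetaV mul1r -mulrA moebiusV mulr1.
  by rewrite mulrA moebiusV mul1r.
elim: n => [|n IHn].
  rewrite expr0 mul1r expr1.
  have -> : (1 - muh) * top_col = muh * ((zh - 1) * top_col).
    by rewrite mulrA mulrBr mulr1 moebiusV.
  have -> : (zh - 1) * top_col = itv_col z.
    apply: incP => A B _; rewrite inc_diag_mulr strict_zetaE.
    have [->|neqB] := eqVneq B \top%O; last first.
      by rewrite mulr0 itv_colE (negPf neqB).
    rewrite mulr1; case: (itvP A) => [->|s t le_st ->].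
      by rewrite itv_col_top ltxx.
    by rewrite itv_col_itv // zetaE le_st lt_neqAle itv_neq_top //= lex1.
  by rewrite mu_col moebiusV mul1r.
rewrite exprS -!mulrA [muh ^+ n * _]mulrA IHn mu_col -exprS -exprSr.
by rewrite mulnS.
Qed.

Lemma moebius_itv n :
  (muh ^+ n) \bot%O \top%O - (muh ^+ n.+1) \bot%O \top%O =
  (mu ^+ (2 * n).+1) \bot%O \top%O.
Proof.
have := congr1 (fun a : incidence (itv_poset P) int => a \bot%O \top%O)
  (moebius_top_col n).
rewrite /= inc_diag_mulr eqxx mulr1 -itv_bot itv_col_itv ?le0x // => <-.
by rewrite mulrBr mulr1 -exprSr inc_subE.
Qed.

End Intervals.

(** * The Veronese transform *)

Lemma chow_poly_itv_veronese {d : Order.disp_t} (P : finTBPOrderType d) :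
  is_veronese 2 (poset_rank P) (chow_poly P) (chow_poly (itv_poset P)).
Proof.
set r := poset_rank P.
have szh := size_chow_poly (itv_poset P); rewrite poset_rank_itv in szh.
split.
- by rewrite (leq_trans (size_chow_poly P)) // geq_max leqnSn.
- by rewrite (leq_trans szh) // geq_max leqnn.
exists (fun n => (-1) ^+ r * (moebius P ^+ n.+1) \bot%O \top%O).
  exact: chow_poly_series.
have := chow_poly_series (itv_poset P); rewrite poset_rank_itv => Hser.
apply: (gen_series_diff Hser) => [|n].
  rewrite muln0 /= -(moebius_itv P 0) expr0 inc_oneE.
  by rewrite -itv_bot (negPf (itv_neq_top _)) ?le0x // sub0r
    [(-1) ^+ r.+1]exprS mulN1r mulrN mulNr.
by rewrite -moebius_itv [(-1) ^+ r.+1]exprS mulN1r !mulNr opprK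
  [RHS]addrC -mulrBr.
Qed.

Theorem theorem1p4 (r : nat) :
  (forall (d : Order.disp_t) (P : finTBPOrderType d),
     eulerian P -> poset_rank P = r ->
     is_veronese 2 r (chow_poly P) (chow_poly (itv_poset P))) /\
  (forall (d1 d2 : Order.disp_t)
          (P1 : finTBPOrderType d1) (P2 : finTBPOrderType d2),
     eulerian P1 -> poset_rank P1 = r ->
     eulerian P2 -> poset_rank P2 = r ->
     (chow_poly P1 = chow_poly P2 <->
      chow_poly (itv_poset P1) = chow_poly (itv_poset P2))).
Proof.
split=> [d P _ <-|d1 d2 P1 P2 _ rk1 _ rk2]; first exact: chow_poly_itv_veronese.
have := chow_poly_itv_veronese P1; have := chow_poly_itv_veronese P2.
rewrite rk1 rk2 => ver2 ver1; split=> eqH.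
  by apply: is_veronese_uniq ver1 _; rewrite eqH.
by apply: veronese2_inj ver1 _; rewrite eqH.
Qed.
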